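(* Let $k=6$, $\alpha\in(0,1)$, $\sigma\geqslant0$, $\tau>0$, and let $q_j^k$, $j\geqslant0$, be the real numbers defined in the context. Then for any positive integer $N$ and any $v^1,\dots,v^N\in H$, $$\sum_{n=1}^N\Big(\sum_{j=0}^{n-1}q_j^k\,v^{n-j},\,v^n\Big)\geqslant 0$$ (if the scalars are complex, the left-hand side is replaced by its real part).
   Context: $(H,(\cdot,\cdot))$ is a Hilbert space. With $k=6$, the real numbers $g_j^k$ are defined by the power series expansion at $\zeta=0$ $$\Big(\sum_{j=1}^{k}\frac1j\,(1-e^{-\sigma\tau}\zeta)^j\Big)^\alpha=\sum_{j=0}^\infty g_j^k\,\zeta^j,$$ where the branch of the power is the one that is positive at $\zeta=0$, and $$q_j^k=\sum_{m=0}^j\frac{243\times 18^{m-1}-15^{m+1}+25\times 10^{m-1}}{30^m}\,e^{-\sigma m\tau}\,g_{j-m}^k ,\qquad j\geqslant 0.$$ Equivalently, $\sum_{j\ge0}q_j^k\zeta^j$ is the power series at $\zeta=0$ of the function $\Big(\sum_{j=1}^{6}\frac1j\,(1-e^{-\sigma\tau}\zeta)^j\Big)^\alpha$ divided by $\left(1-\frac35e^{-\sigma\tau}\zeta\right)\left(1-\frac12e^{-\sigma\tau}\zeta\right)\left(1-\frac13e^{-\sigma\tau}\zeta\right)$. *)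

(* Defs.v *)
From mathcomp Require Import all_boot all_order all_algebra.
From mathcomp Require Import complex.
From mathcomp Require Import all_classical all_reals all_analysis.
Import Order.TTheory GRing.Theory Num.Theory.
Import numFieldNormedType.Exports.

Set Implicit Arguments.
Unset Strict Implicit.
Unset Printing Implicit Defensive.

Local Open Scope classical_set_scope.
Local Open Scope ring_scope.

(* sum_{j=1}^k (1/j) (1 - e^{-sigma tau} z)^j *)
Definition bdf_symbol (R : realType) (k : nat) (sigma tau z : R) : R :=
  \sum_(1 <= j < k.+1) (j%:R)^-1 * (1 - expR (- (sigma * tau)) * z) ^+ j.

(* [g] is the sequence of coefficients of the power series expansion of [f] at
   0.  The series is summed at real points only: this determines [g]. *)
Definition power_series_at0 (R : realType) (f : R -> R) (g : nat -> R) : Prop :=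
  \forall z \near (0 : R), pseries g z @ \oo --> f z.

(* The base [bdf_symbol k sigma tau z] is positive for z near 0 when 0 < k, so
   that [powR] is there the branch of the power that is positive at 0. *)
Definition is_bdf_coef (R : realType) (k : nat) (alpha sigma tau : R)
    (g : nat -> R) : Prop :=
  power_series_at0 (fun z => bdf_symbol k sigma tau z `^ alpha) g.

(* The exponent m - 1 is an integer: it is -1 for m = 0. *)
Definition q6 (R : realType) (sigma tau : R) (g : nat -> R) (j : nat) : R :=
  \sum_(0 <= m < j.+1)
    (243 * 18 ^ (m%:Z - 1) - 15 ^ (m%:Z + 1) + 25 * 10 ^ (m%:Z - 1)) / 30 ^+ m
    * expR (- (sigma * m%:R * tau)) * g (j - m)%N.

(* Main.v *)
(* Put [X = exp (- sigma tau) zeta], [P = \sum_(1 <= j <= 6) (1 - X) ^ j / j] and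
   [D = (1 - 3/5 X) (1 - 1/2 X) (1 - 1/3 X)]. Call a power series accretive when
   its lower triangular Toeplitz forms are nonnegative. Accretive series form a
   cone closed under inversion, hence under harmonic means, and therefore, through
   the arithmetic-harmonic mean iteration, under geometric means. Since [1 / D]
   and [P / D] are accretive (rational dissipation certificates), bisection and continuity
   show that so is [P ^ alpha / D = (P / D) ^ alpha (1 / D) ^ (1 - alpha)] for
   [0 <= alpha <= 1]. The differential equation [P f' = alpha P' f] of
   [f = P ^ alpha] identifies the coefficients [g], and Abel summation takes care
   of the weights [exp (- sigma tau n)]. *)
From Stdlib Require Import BinInt.
From HB Require Import structures.
Require Import Defs.
From mathcomp Require Import all_boot all_order all_algebra.
From mathcomp Require Import complex ring lra zify ssrZ.
From mathcomp Require Import all_classical all_reals all_analysis.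
Import Order.TTheory GRing.Theory Num.Theory.
Import numFieldNormedType.Exports.

Set Implicit Arguments.
Unset Strict Implicit.
Unset Printing Implicit Defensive.

Local Open Scope classical_set_scope.
Local Open Scope ring_scope.

(** * The ring of formal power series and its action on sequences of vectors *)

(* An alias, whose product is the convolution and not the pointwise product. *)
Definition fps (R : realType) : Type := nat -> R.

HB.instance Definition _ (R : realType) := GRing.Lmodule.copy (fps R) (nat -> R).

(** For [V := R^o] this is the product of series; for general [V] it makes the sequences of vectors
    a module over that ring. *)
Definition conv (R : realType) (V : lmodType R) (a : nat -> R) (v : nat -> V) : nat -> V :=
  fun n => \sum_(i < n.+1) a i *: v (n - i)%N.

(** Regrouping along [m = i + j], the combinatorial content of associativity. *)
Lemma sum_triangle (V : zmodType) (n : nat) (F : nat -> nat -> V) :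
  \sum_(i < n.+1) \sum_(j < (n - i).+1) F i (i + j)%N =
  \sum_(m < n.+1) \sum_(i < m.+1) F i m.
Proof.
elim: n => [|n IHn]; first by rewrite !big_ord1.
rewrite big_ord_recr [RHS]big_ord_recr /= subnn big_ord1 addn0 -IHn.
rewrite [X in _ = _ + X]big_ord_recr /= addrA; congr (_ + _).
rewrite -big_split /=; apply: eq_bigr => i _.
by rewrite subSn -1?ltnS // big_ord_recr /= addnS subnKC -1?ltnS.
Qed.

Section Ring.
Variable R : realType.
Implicit Types a b c : fps R.

Definition fps_mul a b : fps R := conv (V := R^o) a b.
Definition fps_one : fps R := fun n => (n == 0%N)%:R.

Lemma conv_assoc (V : lmodType R) a b (v : nat -> V) :
  conv a (conv b v) = conv (fps_mul a b) v.
Proof.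
apply/funext => n; rewrite /conv.
pose F i m := (a i * b (m - i)%N) *: v (n - m)%N.
transitivity (\sum_(i < n.+1) \sum_(j < (n - i).+1) F i (i + j)%N).
  apply: eq_bigr => i _; rewrite scaler_sumr; apply: eq_bigr => j _.
  by rewrite /F scalerA addKn subnDA.
rewrite sum_triangle; apply: eq_bigr => m _; rewrite scaler_suml.
by apply: eq_bigr => i _.
Qed.

Lemma conv1 (V : lmodType R) (v : nat -> V) : conv fps_one v = v.
Proof.
apply/funext => n; rewrite /conv big_ord_recl big1 ?addr0.
  by rewrite /fps_one eqxx scale1r subn0.
by move=> i _; rewrite /fps_one /= scale0r.
Qed.

Lemma convDl (V : lmodType R) a b (v : nat -> V) n :
  conv (a + b) v n = conv a v n + conv b v n.
Proof. by rewrite /conv -big_split; apply: eq_bigr => i _; rewrite scalerDl. Qed.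

Lemma convZl (V : lmodType R) k a (v : nat -> V) n :
  conv (k *: a) v n = k *: conv a v n.
Proof. by rewrite /conv scaler_sumr; apply: eq_bigr => i _; rewrite scalerA. Qed.

Lemma fps_mulA : associative fps_mul.
Proof. by move=> a b c; rewrite /fps_mul conv_assoc. Qed.

Lemma fps_mulC : commutative fps_mul.
Proof.
move=> a b; apply/funext => n; rewrite /fps_mul /conv (reindex_inj rev_ord_inj).
apply: eq_bigr => i _ /=; rewrite subSS subKn -1?ltnS //.
by rewrite -[LHS]/(_ * _) mulrC.
Qed.

Lemma fps_mul1 : left_id fps_one fps_mul.
Proof. by move=> a; rewrite /fps_mul conv1. Qed.

Lemma fps_mulDl : left_distributive fps_mul +%R.
Proof. by move=> a b c; apply/funext => n; rewrite [LHS]convDl. Qed.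

Lemma fps_one_neq0 : fps_one != 0.
Proof.
by apply/eqP => /(congr1 (fun a : fps R => a 0%N)) /eqP; rewrite /fps_one oner_eq0.
Qed.

HB.instance Definition _ := GRing.Zmodule_isComNzRing.Build (fps R)
  fps_mulA fps_mulC fps_mul1 fps_mulDl fps_one_neq0.

Lemma fps_coefM a b n : (a * b) n = \sum_(i < n.+1) a i * b (n - i)%N.
Proof. by []. Qed.

Lemma fps_coefD a b n : (a + b) n = a n + b n. Proof. by []. Qed.
Lemma fps_coefZ k a n : (k *: a) n = k * a n. Proof. by []. Qed.
Lemma fps_coef1 n : (1 : fps R) n = (n == 0%N)%:R. Proof. by []. Qed.

Lemma fps_scalerAl k a b : k *: (a * b) = (k *: a) * b.
Proof. by apply/funext => n; rewrite [RHS]convZl. Qed.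

HB.instance Definition _ := GRing.Lmodule_isLalgebra.Build R (fps R) fps_scalerAl.
Lemma fps_scalerAr k a b : k *: (a * b) = a * (k *: b).
Proof. by rewrite mulrC fps_scalerAl mulrC. Qed.
HB.instance Definition _ := GRing.Lalgebra_isAlgebra.Build R (fps R) fps_scalerAr.

Lemma convM (V : lmodType R) a b (v : nat -> V) :
  conv (a * b) v = conv a (conv b v).
Proof. by rewrite conv_assoc. Qed.

End Ring.

(** Since [F n] looks only below [n], iterating [F] as a map on sequences [k] times settles all
    values below [k]; the diagonal [h n.+1 n] is the solution. *)
Lemma course_of_values (T : Type) (t0 : T) (F : nat -> (nat -> T) -> T) :
  (forall n f g, (forall i, (i < n)%N -> f i = g i) -> F n f = F n g) ->
  exists y, forall n, y n = F n y.
Proof.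
move=> FP; pose h k := iter k (fun f n => F n f) (fun=> t0).
have hS n k : (n < k)%N -> h k n = h n.+1 n.
  elim/ltn_ind: n k => n IHn [//|k] nk /=; apply: FP => i ltin.
  by rewrite (IHn i ltin k (leq_trans ltin nk)) (IHn i ltin n ltin).
exists (fun n => h n.+1 n) => n /=; apply: FP => i ltin.
by rewrite (hS i n ltin).
Qed.

Lemma fps_inv (R : realType) (a : fps R) : a 0%N != 0 -> exists b, a * b = 1.
Proof.
move=> a0.
have [|b bE] := @course_of_values R 0 (fun n b =>
  ((n == 0%N)%:R - \sum_(i < n) a i.+1 * b (n - i.+1)%N) / a 0%N).
  move=> n f g fg; congr ((_ - _) / _); apply: eq_bigr => i _.
  by rewrite fg // ltn_subrL /= (leq_ltn_trans _ (ltn_ord i)).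
exists b; apply/funext => n; rewrite fps_coefM big_ord_recl /= subn0 (bE n).
by rewrite mulrC divfK // subrK.
Qed.

(** * Positive semidefinite forms *)

(** Covers both a real inner product and the real part of a complex one. *)
Definition psd_form (R : realType) (V : lmodType R) (B : V -> V -> R) :=
  [/\ forall k x y z, B (k *: x + y) z = k * B x z + B y z,
      forall x y, B x y = B y x & forall x, 0 <= B x x].

Section PsdForm.
Variables (R : realType) (V : lmodType R) (B : V -> V -> R).
Hypothesis hB : psd_form B.

Lemma psd_formDl x y z : B (x + y) z = B x z + B y z.
Proof. by case: hB => BP _ _; rewrite -[x]scale1r BP mul1r scale1r. Qed.

Lemma psd_form0l z : B 0 z = 0.
Proof. by apply: (addrI (B 0 z)); rewrite -psd_formDl !addr0. Qed.

Lemma psd_formZl k x z : B (k *: x) z = k * B x z.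
Proof. by case: hB => BP _ _; rewrite -[k *: x]addr0 BP psd_form0l addr0. Qed.

Lemma psd_formZr k x y : B x (k *: y) = k * B x y.
Proof. by case: hB => _ BC _; rewrite !(BC x) psd_formZl. Qed.

Lemma psd_form_suml (I : Type) (r : seq I) (F : I -> V) z :
  B (\sum_(i <- r) F i) z = \sum_(i <- r) B (F i) z.
Proof. exact: (big_morph (B^~ z) (fun x y => psd_formDl x y z) (psd_form0l z)). Qed.

Lemma psd_form_sumr (I : Type) (r : seq I) (F : I -> V) x :
  B x (\sum_(i <- r) F i) = \sum_(i <- r) B x (F i).
Proof.
case: hB => _ BC _; rewrite BC psd_form_suml; apply: eq_bigr => i _; exact: BC.
Qed.

End PsdForm.

(** * Accretive series and their geometric means *)

Definition accretive (R : realType) (a : fps R) :=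
  forall (V : lmodType R) (B : V -> V -> R), psd_form B ->
  forall (v : nat -> V) N, 0 <= \sum_(n < N) B (conv a v n) (v n).

Definition vanish (R : realType) m (a : fps R) := forall n, (n < m)%N -> a n = 0.

Section Accretive.
Variable R : realType.
Implicit Types a b c : fps R.

Lemma accretiveD a b : accretive a -> accretive b -> accretive (a + b).
Proof.
move=> ha hb V B hB v N.
under eq_bigr do rewrite convDl (psd_formDl hB).
by rewrite big_split addr_ge0 //; [exact: ha | exact: hb].
Qed.

Lemma accretiveZ k a : 0 <= k -> accretive a -> accretive (k *: a).
Proof.
move=> k0 ha V B hB v N.
under eq_bigr do rewrite convZl (psd_formZl hB).
by rewrite -mulr_sumr mulr_ge0 //; exact: ha.
Qed.

(* Substituting [w = b v], so that [v = a w], exchanges the roles of [v] and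
   of its image. *)
Lemma accretive_inv a b : a * b = 1 -> accretive a -> accretive b.
Proof.
move=> ab1 ha V B hB v N.
have {2}-> : v = conv a (conv b v) by rewrite -convM ab1 conv1.
by have [_ BC _] := hB; under eq_bigr do rewrite BC; exact: ha.
Qed.

(** The form with [N] terms sees only the coefficients of index below [N]. *)
Lemma accretive_local a :
  (forall N, exists b, accretive b /\ vanish N (a - b)) -> accretive a.
Proof.
move=> ha V B hB v N; have [b [hb ab]] := ha N.
rewrite (eq_bigr (fun n : 'I_N => B (conv b v n) (v n))); first exact: hb.
move=> n _; congr (B _ _); apply: eq_bigr => i _; congr (_ *: _).
apply/eqP; rewrite -subr_eq0; apply/eqP; apply: ab.
by rewrite (leq_ltn_trans _ (ltn_ord n)) // -ltnS.
Qed.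

Lemma fps_coefM0 a b : (a * b) 0%N = a 0%N * b 0%N.
Proof. by rewrite fps_coefM big_ord1. Qed.

Lemma vanishM m k a b : vanish m a -> vanish k b -> vanish (m + k) (a * b).
Proof.
move=> ha hb n nmk; rewrite fps_coefM big1 // => i _.
have [im|mi] := ltnP i m; first by rewrite ha // mul0r.
rewrite hb ?mulr0 // ltn_subLR; last by rewrite -ltnS.
by rewrite (leq_trans nmk) // leq_add2r.
Qed.

Lemma vanish_le m k a : (m <= k)%N -> vanish k a -> vanish m a.
Proof. by move=> mk ha n nm; apply: ha; apply: leq_trans mk. Qed.

(* The arithmetic-harmonic mean iteration [X' = (X + Y) / 2, Y' = 2 X Y / (X + Y)]
   preserves accretivity and the product [X Y = c ^+ 2]; it is also Newton's
   iteration for [c], so that [X] agrees with [c] to an increasing order. *)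
Lemma accretive_geometric_mean a b c :
  a 0%N = 1 -> b 0%N = 1 -> c 0%N = 1 -> c ^+ 2 = a * b ->
  accretive a -> accretive b -> accretive c.
Proof.
move=> a0 b0 c0 cE ha hb.
apply: accretive_local => N.
suff [X [Y [_ hX _ _ [_ cX]]]] : exists X Y : fps R, [/\ c ^+ 2 = X * Y,
    accretive X, accretive Y, X 0%N = 1 & Y 0%N = 1 /\ vanish N.+1 (c - X)].
  by exists X; split => //; apply: vanish_le cX.
elim: N => [|N [X [Y [cXY hX hY X0 [Y0 cX]]]]].
  exists a, b; split=> //; split=> // -[|//] _.
  by rewrite fps_coefD (_ : (- a) 0%N = - a 0%N) // a0 c0 subrr.
have [Xi XXi] : exists Xi, X * Xi = 1 by apply: fps_inv; rewrite X0 oner_eq0.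
have [Yi YYi] : exists Yi, Y * Yi = 1 by apply: fps_inv; rewrite Y0 oner_eq0.
have Xi0 : Xi 0%N = 1.
  by have := congr1 (fun f : fps R => f 0%N) XXi; rewrite fps_coefM0 X0 mul1r.
have Yi0 : Yi 0%N = 1.
  by have := congr1 (fun f : fps R => f 0%N) YYi; rewrite fps_coefM0 Y0 mul1r.
(* The scalar 1/2 is made a series so that [ring] can compute in [fps R] without scalings. *)
pose h : fps R := 2^-1 *: 1.
have hh : h + h = 1.
  by rewrite -scalerDl -[2^-1]mul1r -splitr scale1r.
have hE f : h * f = 2^-1 *: f by rewrite -scalerAl mul1r.
have half0 f g : f 0%N = 1 -> g 0%N = 1 -> (h * (f + g)) 0%N = 1.
  by move=> f0 g0; rewrite hE fps_coefZ fps_coefD f0 g0 mulrDr mulr1 -[2^-1]mul1r -splitr.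
(* [W] is the mean of the inverses; its inverse [Y'] is the harmonic mean. *)
pose W := h * (Xi + Yi).
have hW : accretive W.
  rewrite /W hE; apply: accretiveZ; first by rewrite invr_ge0.
  by apply: accretiveD; [apply: accretive_inv hX | apply: accretive_inv hY].
have W0 : W 0%N = 1 by exact: half0.
have [Y' WY'] : exists Y', W * Y' = 1 by apply: fps_inv; rewrite W0 oner_eq0.
have WXY : W * (X * Y) = h * (X + Y) by rewrite /W; ring: XXi YYi.
exists (h * (X + Y)), Y'; split => //.
- by rewrite cXY -WXY -[LHS]mul1r -WY'; ring.
- rewrite hE; apply: accretiveZ; first by rewrite invr_ge0.
  exact: accretiveD.
- exact: accretive_inv hW.
- exact: half0.
split.
  by have := congr1 (fun f : fps R => f 0%N) WY'; rewrite fps_coefM0 W0 mul1r.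
(* Newton's error identity [c - (X + Y) / 2 = - (c - X) ^+ 2 / (2 X)]: the order of vanishing
   doubles. *)
have -> : c - h * (X + Y) = - (Xi * h) * ((c - X) * (c - X)).
  have -> : c - h * (X + Y) = X * Xi * (c * (h + h) - h * (X + Y)).
    by rewrite hh XXi mulr1 mul1r.
  have cXY' : c * c = X * Y by rewrite -expr2.
  by ring: XXi cXY'.
apply: (@vanish_le _ (0 + (N.+1 + N.+1))%N); first by rewrite add0n addSn ltnS leq_addl.
by apply: vanishM => //; apply: vanishM.
Qed.

End Accretive.

(** * Real powers of a power series *)

Lemma continuous_sum (R : realType) (I : Type) (r : seq I) (F : I -> R -> R) :
  (forall i, continuous (F i)) -> continuous (fun t => \sum_(i <- r) F i t).
Proof.
move=> hF t; apply: cvg_big => [x|i _]; [exact: add_continuous | exact: hF].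
Qed.

Section Powers.
Variable R : realType.
Implicit Types a b y z : fps R.

(* Euler's operator [x d/dx]. *)
Definition euler a : fps R := fun n => n%:R * a n.

Lemma eulerM a b : euler (a * b) = euler a * b + a * euler b.
Proof.
apply/funext => n; rewrite fps_coefD /euler !fps_coefM mulr_sumr -big_split.
apply: eq_bigr => i _ /=.
by rewrite -{1}(subnKC (ltn_ord i : (i <= n)%N)) natrD; ring.
Qed.

Lemma eulerZ k a : euler (k *: a) = k *: euler a.
Proof. by apply/funext => n; rewrite /euler !fps_coefZ mulrCA. Qed.

Lemma euler1 : euler 1 = 0.
Proof.
by apply/funext => -[|n]; rewrite /euler fps_coef1 ?mul0r //= mulr0.
Qed.

(* [y = a `^ al], characterized by [a dy = al y da]. *)
Definition is_fps_pow a (al : R) y :=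
  y 0%N = 1 /\ a * euler y = al *: (euler a * y).

(** Coefficient [n.+1] of the differential equation. As [a 0 = 1], it yields [y n.+1] from earlier
    coefficients, whence existence, uniqueness and continuity in [al]. *)
Lemma is_fps_powP a al y : a 0%N = 1 ->
  is_fps_pow a al y <-> y 0%N = 1 /\ forall n,
    n.+1%:R * y n.+1 = \sum_(i < n.+1)
      (al * i.+1%:R - (n - i)%:R) * a i.+1 * y (n - i)%N.
Proof.
move=> a0; pose S n := \sum_(i < n.+1)
      (al * i.+1%:R - (n - i)%:R) * a i.+1 * y (n - i)%N.
have coefE n : (a * euler y - al *: (euler a * y)) n.+1 = n.+1%:R * y n.+1 - S n.
  rewrite fps_coefD (_ : (- (al *: (euler a * y))) n.+1 = - (al *: (euler a * y)) n.+1) //.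
  rewrite fps_coefZ !fps_coefM big_ord_recl [in X in _ - X]big_ord_recl /=.
  rewrite /euler a0 mul1r subn0 !mul0r add0r -addrA; congr (_ + _).
  rewrite mulr_sumr -sumrB /S -sumrN; apply: eq_bigr => i _ /=.
  by rewrite /bump /= add1n subSS; ring.
split=> -[y0 yE]; split=> //.
  by move=> n; apply/eqP; rewrite -subr_eq0 -[X in _ - X]/(S n) -coefE yE subrr.
apply/eqP; rewrite -subr_eq0; apply/eqP/funext => -[|n]; last first.
  by rewrite coefE yE subrr.
rewrite fps_coefD (_ : (- (al *: (euler a * y))) 0%N = - (al *: (euler a * y)) 0%N) //.
by rewrite fps_coefZ !fps_coefM !big_ord1 /euler !mul0r !mulr0 subrr.
Qed.

Lemma fps_pow_exists a al : a 0%N = 1 -> exists y, is_fps_pow a al y.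
Proof.
move=> a0.
have [|y yE] := @course_of_values R 0 (fun n y => if n is m.+1 then
    m.+1%:R^-1 * \sum_(i < m.+1) (al * i.+1%:R - (m - i)%:R) * a i.+1 * y (m - i)%N
  else 1).
  move=> [//|n] f g fg; congr (_ * _); apply: eq_bigr => i _.
  by rewrite fg // ltnS leq_subr.
exists y; apply/is_fps_powP => //; split=> [|n]; first by rewrite yE.
by rewrite (yE n.+1) mulrA divff ?mul1r // pnatr_eq0.
Qed.

Lemma fps_pow_unique a al y z : a 0%N = 1 ->
  is_fps_pow a al y -> is_fps_pow a al z -> y = z.
Proof.
move=> a0 /(is_fps_powP _ _ a0)[y0 yE] /(is_fps_powP _ _ a0)[z0 zE].
apply/funext; elim/ltn_ind => -[|n] IHn; first by rewrite y0 z0.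
have nn0 : n.+1%:R != 0 :> R by rewrite pnatr_eq0.
apply: (mulfI nn0); rewrite yE zE; apply: eq_bigr => i _.
by rewrite IHn // ltnS leq_subr.
Qed.

Lemma fps_pow0 a : is_fps_pow a 0 1.
Proof. by split; rewrite ?fps_coef1 // euler1 mulr0 scale0r. Qed.

Lemma fps_pow1 a : a 0%N = 1 -> is_fps_pow a 1 a.
Proof. by move=> a0; split=> //; rewrite scale1r mulrC. Qed.

Lemma fps_powD a al be y z :
  is_fps_pow a al y -> is_fps_pow a be z -> is_fps_pow a (al + be) (y * z).
Proof.
move=> [y0 yE] [z0 zE]; split; first by rewrite fps_coefM0 y0 z0 mulr1.
rewrite eulerM mulrDr mulrA yE mulrCA zE scalerDl -!scalerAl mulrA.
congr (_ + _); rewrite -scalerAr; congr (_ *: _); ring.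
Qed.

(** By the recursion, each coefficient is a polynomial in [al]. *)
Lemma fps_pow_continuous a (y : R -> fps R) : a 0%N = 1 ->
  (forall al, is_fps_pow a al (y al)) -> forall n, continuous (fun al => y al n).
Proof.
move=> a0 hy; elim/ltn_ind => -[|n] IHn.
  rewrite (_ : (fun _ => _) = fun=> 1); first by move=> ?; exact: cvg_cst.
  by apply/funext => al; case: (hy al).
rewrite (_ : (fun _ => _) = fun al => n.+1%:R^-1 * \sum_(i < n.+1)
      (al * i.+1%:R - (n - i)%:R) * a i.+1 * y al (n - i)%N); last first.
  apply/funext => al; have [_ <-] := (is_fps_powP _ _ a0).1 (hy al).
  by rewrite mulKf // pnatr_eq0.
move=> al; apply: cvgM; first exact: cvg_cst.
apply: continuous_sum => i {}al; apply: cvgM; last first.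
  by apply: IHn; rewrite ltnS leq_subr.
apply: cvgM; last exact: cvg_cst.
by apply: cvgB; [apply: cvgM; [exact: cvg_id | exact: cvg_cst] | exact: cvg_cst].
Qed.

End Powers.

(** * Interpolation of accretivity between the exponents 0 and 1 *)

Lemma dyadic_dense (R : realType) (P : set R) : P 0 -> P 1 ->
  (forall x y, P x -> P y -> P ((x + y) / 2)) ->
  forall x : R, 0 <= x <= 1 -> exists u : nat -> R, (forall n, P (u n)) /\ u @ \oo --> x.
Proof.
move=> P0 P1 Pmid.
have dyP n k : (k <= 2 ^ n)%N -> P (k%:R / 2 ^+ n).
  elim: n k => [|n IHn] k; rewrite ?expn0 ?expr0 ?divr1.
    by case: k => [|[|]].
  (* A dyadic number of level [n.+1] is the midpoint of two of level [n], with numerators [k / 2]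
     rounded down and up. *)
  rewrite expnS mul2n => kn; have -> : k%:R / 2 ^+ n.+1 =
      (k./2%:R / 2 ^+ n + (uphalf k)%:R / 2 ^+ n) / 2 :> R.
    rewrite -mulrDl -natrD uphalf_half addnCA addnn odd_double_half.
    by rewrite exprSr invfM mulrA.
  by apply: Pmid; apply: IHn; rewrite ?leq_half_double ?leq_uphalf_double // leqW.
move=> x /andP[x0 x1].
have xn0 n : 0 <= x * 2 ^+ n by rewrite mulr_ge0 // exprn_ge0.
exists (fun n => (Num.truncn (x * 2 ^+ n))%:R / 2 ^+ n); split.
  move=> n; apply: dyP; rewrite -(ler_nat R) natrX.
  rewrite (le_trans (y := x * 2 ^+ n)) ?truncn_le //.
  by rewrite ler_piMl // exprn_ge0.
have p2 n : 0 < 2 ^+ n :> R by rewrite exprn_gt0.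
apply: (@squeeze_cvgr _ _ _ _ (fun n => x - 2^-1 ^+ n) (fun=> x)).
- near=> n; have /andP[tl tg] := truncn_itv (xn0 n).
  rewrite ler_pdivrMr // tl andbT ler_pdivlMr // mulrBl exprVn mulVf ?gt_eqF //.
  by rewrite lerBlDr natr1 ltW.
- rewrite -[X in _ --> X]subr0; apply: cvgB; first exact: cvg_cst.
  by apply: cvg_expr; rewrite ger0_norm ?invr_ge0 // invf_lt1 // ltr1n.
- exact: cvg_cst.
Unshelve. all: by end_near. Qed.

Section Interpolation.
Variable R : realType.
Implicit Types a e y : fps R.

(** The exponents 0 and 1 give [e] and [a * e]; a midpoint of exponents gives a geometric mean, and
    dyadic exponents are dense. *)
Lemma accretive_interpolation a e al y : a 0%N = 1 -> e 0%N = 1 ->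
  accretive e -> accretive (a * e) -> 0 <= al <= 1 ->
  is_fps_pow a al y -> accretive (y * e).
Proof.
move=> a0 e0 he hae al01 hy.
have /choice[Y hY] al' := fps_pow_exists al' a0.
rewrite (fps_pow_unique a0 hy (hY al)).
have [|||u [hu u_al]] := @dyadic_dense R [set t | accretive (Y t * e)] _ _ _ _ al01.
- by rewrite /= (fps_pow_unique a0 (hY 0) (fps_pow0 a)) mul1r.
- by rewrite /= (fps_pow_unique a0 (hY 1) (fps_pow1 a0)).
- move=> /= be ga hbe hga.
  have Y0 p : (Y p * e) 0%N = 1 by rewrite fps_coefM0 e0 mulr1; case: (hY p).
  apply: accretive_geometric_mean hbe hga => //.
  have YY : Y ((be + ga) / 2) * Y ((be + ga) / 2) = Y be * Y ga.
    apply: (fps_pow_unique a0 _ (fps_powD (hY be) (hY ga))).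
    by rewrite [X in is_fps_pow _ X](splitr (be + ga)); apply: fps_powD.
  by rewrite expr2 mulrACA YY mulrACA.
move=> V B hB v N; pose form t := \sum_(n < N) B (conv (Y t * e) v n) (v n).
(* For fixed [v] and [N] only finitely many coefficients of [Y t] enter, and linearly. *)
have form_cont : continuous form.
  rewrite (_ : form = fun t => \sum_(n < N) \sum_(i < n.+1) \sum_(j < i.+1)
      Y t j * (e (i - j)%N * B (v (n - i)%N) (v n))).
    apply: continuous_sum => n; apply: continuous_sum => i.
    apply: continuous_sum => j t; apply: cvgM; last exact: cvg_cst.
    exact: (fps_pow_continuous a0 hY).
  apply/funext => t; apply: eq_bigr => n _; rewrite (psd_form_suml hB).
  apply: eq_bigr => i _; rewrite (psd_formZl hB) fps_coefM mulr_suml.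
  by apply: eq_bigr => j _; rewrite mulrA.
have form_u : form (u n) @[n --> \oo] --> form al.
  exact: (continuous_cvg _ (form_cont al)).
have form_ge0 : [set t | 0 <= t] (form al).
  apply: (closed_cvg _ (@closed_ge R 0) _ _ form_u).
  by apply: nearW => n; exact: (hu n).
exact: form_ge0.
Qed.

End Interpolation.

(** * Dissipation inequalities and their certificates *)

(** Polynomials as series: the default value of [nth] supplies the zeros past the end. *)
Definition fps_seq (R : realType) (s : seq R) : fps R := fun n => s`_n.

Section Dissipation.
Variable R : realType.
Implicit Types (l p k : seq R) (L G M : seq (R * seq R)).

(* A list of pairs [(c, l)] encodes the quadratic form [\sum c (l . x) ^ 2]. *)
Definition sosmx L i j := \sum_(cl <- L) cl.1 * cl.2`_i * cl.2`_j.

Definition shift_sos L := [seq (cl.1, 0 :: cl.2) | cl <- L].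

Section Form.
Variables (V : lmodType R) (B : V -> V -> R).
Hypothesis hB : psd_form B.
Implicit Types x : nat -> V.

Definition lincomb m l x := \sum_(i < m) l`_i *: x i.

Definition sosform m L x :=
  \sum_(cl <- L) cl.1 * B (lincomb m cl.2 x) (lincomb m cl.2 x).

Lemma form_lincomb m l l' x :
  B (lincomb m l x) (lincomb m l' x) =
  \sum_(i < m) \sum_(j < m) l`_i * l'`_j * B (x i) (x j).
Proof.
rewrite (psd_form_suml hB); apply: eq_bigr => i _.
rewrite (psd_form_sumr hB); apply: eq_bigr => j _.
by rewrite (psd_formZl hB) (psd_formZr hB) mulrA.
Qed.

Lemma sosformE m L x :
  sosform m L x = \sum_(i < m) \sum_(j < m) sosmx L i j * B (x i) (x j).
Proof.
rewrite /sosform; under eq_bigr do rewrite form_lincomb mulr_sumr.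
rewrite exchange_big; apply: eq_bigr => i _ /=.
under eq_bigr do rewrite mulr_sumr.
rewrite exchange_big; apply: eq_bigr => j _ /=.
by rewrite /sosmx mulr_suml; apply: eq_bigr => cl _; rewrite !mulrA.
Qed.

Lemma sosform_ge0 m L x : all (fun cl => 0 <= cl.1) L -> 0 <= sosform m L x.
Proof.
move=> /allP L0; rewrite /sosform big_seq; apply: sumr_ge0 => cl /L0 cl0.
by apply: mulr_ge0 => //; case: hB => _ _; apply.
Qed.

Lemma sosform_shift m L x :
  sosform m.+1 (shift_sos L) x = sosform m L (fun i => x i.+1).
Proof.
rewrite /sosform big_map; apply: eq_bigr => cl _ /=.
by rewrite /lincomb big_ord_recl /= scale0r add0r.
Qed.

Lemma sosform_widen m L x : all (fun cl => (size cl.2 <= m)%N) L ->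
  sosform m.+1 L x = sosform m L x.
Proof.
move=> /allP Lm; rewrite /sosform big_seq [RHS]big_seq; apply: eq_bigr => cl /Lm clm.
by rewrite /lincomb big_ord_recr /= nth_default // scale0r addr0.
Qed.

Lemma sosform0 m L : sosform m L (fun=> 0) = 0.
Proof.
rewrite /sosform big1 // => cl _.
by rewrite /lincomb big1 ?(psd_form0l hB) ?mulr0 // => i _; rewrite scaler0.
Qed.

(** The state of a delay line at time [N]: the latest value [v (N - 1)] comes first, and the values
    before time 0 are zero. *)
Definition lag (v : nat -> V) N : nat -> V :=
  fun i => if (i < N)%N then v (N - i.+1)%N else 0.

Lemma conv_fps_seq m l v n : (size l <= m)%N ->
  conv (fps_seq l) v n = lincomb m l (lag v n.+1).
Proof.
move=> lm; rewrite /conv /lincomb /fps_seq.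
(* A common range for both sums: [lag v n.+1] vanishes from [n.+1] on, and [l] from [m] on. *)
transitivity (\sum_(i < n.+1 + m) l`_i *: lag v n.+1 i).
  rewrite big_split_ord /= [X in _ + X]big1 ?addr0; last first.
    by move=> i _; rewrite /lag ltnNge leq_addr scaler0.
  by apply: eq_bigr => i _; rewrite /lag /= ltn_ord subSS.
rewrite addnC big_split_ord /= [X in _ + X]big1 ?addr0 // => i _.
by rewrite nth_default ?scale0r // (leq_trans lm) // leq_addr.
Qed.

(* The storage function [sosform m G] of the delayed values is dominated by
   the energy supplied so far. *)
Lemma dissipation (w : R) m p k G M (v : nat -> V) N : 0 < w ->
  (size p <= m.+1)%N -> (size k <= m.+1)%N ->
  all (fun cl => (size cl.2 <= m)%N) G -> all (fun cl => 0 <= cl.1) (G ++ M) ->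
  (forall i j, (i < m.+1)%N -> (j < m.+1)%N ->
     w * (p`_i * k`_j + k`_i * p`_j) + sosmx (shift_sos G) i j =
     sosmx G i j + sosmx M i j) ->
  0 <= \sum_(n < N) B (conv (fps_seq p) v n) (conv (fps_seq k) v n).
Proof.
move=> w0 pm km Gm; rewrite all_cat => /andP[G0 M0] pkE.
have w2 : 0 < w * 2 by rewrite mulr_gt0.
rewrite -(pmulr_rge0 _ w2).
apply: (le_trans (sosform_ge0 m (lag v N) G0)).
elim: N => [|N IHN]; first by rewrite big_ord0 mulr0 sosform0.
rewrite big_ord_recr /= mulrDr -lerBlDr; apply: le_trans IHN.
rewrite !(conv_fps_seq _ _ pm) (conv_fps_seq _ _ km).
set x := lag v N.+1.
(* The energy balance of one time step: the supply is the increase of the storage plus the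
   dissipated squares [M]. The factor 2 comes from the symmetrized identity. *)
have -> : w * 2 * B (lincomb m.+1 p x) (lincomb m.+1 k x) =
    sosform m G x - sosform m G (lag v N) + sosform m.+1 M x.
  rewrite -mulrA mulr2n mulrDl mul1r; have [_ BC _] := hB; rewrite [X in _ + X]BC.
  rewrite !form_lincomb -big_split -(sosform_widen _ Gm) mulr_sumr.
  have -> : lag v N = (fun i => x i.+1) by apply/funext => i; rewrite /x /lag ltnS subSS.
  rewrite -sosform_shift !sosformE -sumrB -big_split; apply: eq_bigr => i _ /=.
  rewrite -big_split -sumrB -big_split mulr_sumr; apply: eq_bigr => j _ /=.
  rewrite -mulrBl -!mulrDl mulrA; congr (_ * _).
  by rewrite addrAC -pkE // addrK.
by rewrite opprD addrA opprB addrCA subrr addr0 gerBl sosform_ge0.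
Qed.

End Form.

End Dissipation.

(* The coefficients of the certificates are large: the identity between
   quadratic forms is checked by computation on binary integers. *)
Section Certificate.
Variable R : realType.

Definition Zr (z : Z) : R := (int_of_Z z)%:~R.

HB.instance Definition _ := GRing.RMorphism.copy Zr (intr \o int_of_Z).

Definition sosmxZ (L : seq (Z * seq Z)) i j : Z :=
  foldr (fun cl s => cl.1 * cl.2`_i * cl.2`_j + s) 0 L.

(** The hypotheses of [dissipation] in decidable form; the factor [w] clears the denominators. *)
Definition certificate (w : Z) m (p k : seq Z) (G M : seq (Z * seq Z)) :=
  let G' := [seq (cl.1, 0 :: cl.2) | cl <- G] in
  [&& 0 < w, (size p <= m.+1)%N, (size k <= m.+1)%N,
      all (fun cl => (size cl.2 <= m)%N) G, all (fun cl => 0 <= cl.1) (G ++ M) &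
      all (fun i => all (fun j =>
        w * (p`_i * k`_j + k`_i * p`_j) + sosmxZ G' i j == sosmxZ G i j + sosmxZ M i j)
      (iota 0 m.+1)) (iota 0 m.+1)].

Let Zr_sos (L : seq (Z * seq Z)) := [seq (Zr cl.1, map Zr cl.2) | cl <- L].

Lemma nth_map_Zr (l : seq Z) i : (map Zr l)`_i = Zr l`_i.
Proof.
have [il|li] := ltnP i (size l); first exact: nth_map.
by rewrite !nth_default ?size_map.
Qed.

Lemma sosmx_Zr L i j : sosmx (Zr_sos L) i j = Zr (sosmxZ L i j).
Proof.
rewrite /sosmx big_map; elim: L => [|cl L IHL]; first by rewrite big_nil.
by rewrite big_cons IHL !nth_map_Zr /= !rmorphD !rmorphM.
Qed.

Lemma Zr_ge0 z : 0 <= z -> 0 <= Zr z.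
Proof. by move=> z0; rewrite ler0z; case: z z0. Qed.

Lemma Zr_gt0 z : 0 < z -> 0 < Zr z.
Proof. by case: z => // z _; rewrite ltr0z /=; lia. Qed.

(** With [u = conv b v], the form pairs [p u] with [k u], which is the setting of [dissipation]. *)
Lemma accretive_certificate w m p k G M (b : fps R) :
  certificate w m p k G M ->
  fps_seq (map Zr k) * b = 1 -> accretive (fps_seq (map Zr p) * b).
Proof.
move=> /and5P[w0 pm km Gm /andP[GM0 /allP pkE]] kb1 V B hB v N.
have {2}-> : v = conv (fps_seq (map Zr k)) (conv b v) by rewrite -convM kb1 conv1.
under eq_bigr do rewrite convM.
apply: (dissipation hB (w := Zr w) (m := m) (G := Zr_sos G) (M := Zr_sos M));
  rewrite ?size_map //.
- exact: Zr_gt0.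
- by rewrite all_map; apply/allP => cl /(allP Gm) /=; rewrite size_map.
- rewrite -map_cat all_map; apply/allP => cl /(allP GM0) /=.
  exact: Zr_ge0.
move=> i j im jm.
have -> : shift_sos (Zr_sos G) = Zr_sos [seq (cl.1, 0 :: cl.2) | cl <- G].
  by rewrite /shift_sos /Zr_sos -!map_comp; apply: eq_map.
have iI : i \in iota 0 m.+1 by rewrite mem_iota.
have jI : j \in iota 0 m.+1 by rewrite mem_iota.
have /eqP ijE := allP (pkE i iI) j jI.
by rewrite !sosmx_Zr !nth_map_Zr -rmorphD -ijE !rmorphD !rmorphM !rmorphD !rmorphM.
Qed.

End Certificate.

(** * Explicit certificates for the six-step method *)

Section Bdf6Certificates.
Local Open Scope Z_scope.

(** The coefficients of [30 D]; the next two lists are the [p] and [k] of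
    [accretive_bdf6_quotient]. *)
Definition scaled_multiplier : seq Z := [:: 30; -43; 20; -3].
Definition reduced_bdf6 : seq Z := [:: 147; -213; 237; -163; 62; -10].
Definition reduced_multiplier : seq Z := [:: 753; -471; 105; -59; 42; -10].

(* [(a, b, l)] stands for the square [a / b * (l . x) ^ 2]. *)
Definition clear_denominators (w : Z) (L : seq (Z * Z * seq Z)) : seq (Z * seq Z) :=
  [seq (cl.1.1 * (w / cl.1.2), cl.2) | cl <- L].

Definition lcm_denominators (L : seq (Z * Z * seq Z)) : Z :=
  foldr (fun cl => Z.lcm cl.1.2) 1 L.

Lemma multiplier_certificate : exists w G M,
  certificate w 3 [:: 1] scaled_multiplier G M.
Proof.
pose G := [:: (2, 1, [:: 3; -3; 2]); (4, 3, [:: -4; 3]); (44, 3, [:: 1])].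
pose M := [:: (1, 8, [:: -3; 12; -12; 8]); (1, 16, [:: 7; -8; 8]);
  (1, 2, [:: -1; 2]); (21, 16, [:: 1])].
pose w := lcm_denominators (G ++ M).
by exists w, (clear_denominators w G), (clear_denominators w M); vm_compute.
Qed.

(* [G] is a rounding of the analytic center of the linear matrix inequality
   that the Kalman-Yakubovich-Popov lemma attaches to the pair; the squares come
   from Gaussian elimination on [G] and [M]. *)
Lemma reduced_certificate : exists w G M,
  certificate w 5 reduced_multiplier reduced_bdf6 G M.
Proof.
pose G := [::
  (1000, 21, [:: 63; -63; 48; -27; 8]);
  (75, 1, [:: 0; 40; -27; 17; -7]);
  (25, 118797, [:: 0; 0; 16971; -8361; 4351]);
  (60000, 19680703, [:: 0; 0; 0; 3479; -1144]);
  (53241000, 3479, [:: 0; 0; 0; 0; 1])].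
pose M := [::
  (2, 151, [:: -450; 1542; -2421; 2511; -2002; 1510]);
  (1, 1717021, [:: 127803; -251109; 273819; -233453; 227420]);
  (3, 904290043661, [:: -68488181; 60319203; -46811333; 79525991]);
  (3000, 10964723069810279, [:: 117936737; 22975638; 137875969]);
  (150, 552471706212679, [:: 28799241; 28049137]);
  (116841588000, 196343959, [:: 1])].
pose w := lcm_denominators (G ++ M).
by exists w, (clear_denominators w G), (clear_denominators w M); vm_compute.
Qed.

(** The quotient [(1 + X) / (1 - X)] is lossless, so that no dissipated square occurs. *)
Lemma cayley_certificate : certificate 1 1 [:: 1; 1] [:: 1; -1] [:: (2, [:: 1])] [::].
Proof. by vm_compute. Qed.

End Bdf6Certificates.

(** * Accretivity of [1 / D] and of [P / D] *)

Section Bdf6.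
Variable R : realType.
Implicit Types a e : fps R.

(** The number of terms does not depend on [n], so that identities reduce to finitely many cases. *)
Lemma fps_seqM m (l : seq R) a n : (size l <= m)%N ->
  (fps_seq l * a) n = \sum_(i < m) l`_i * (if (i < n.+1)%N then a (n - i)%N else 0).
Proof. by move=> lm; rewrite [LHS](conv_fps_seq (V := R^o) _ _ lm). Qed.

(** [P] expanded in powers of [X]; [multiplier] is likewise [D]. *)
Definition bdf6 : fps R := fps_seq [:: 49 / 20; -6; 15 / 2; - (20 / 3); 15 / 4; - (6 / 5); 1 / 6].

Definition multiplier : fps R := fps_seq [:: 1; - (43 / 30); 2 / 3; - (1 / 10)].

(** The coefficients of [1 / D], from its partial fractions. *)
Definition inv_multiplier : fps R := fun n =>
  27 / 2 * (3 / 5) ^+ n - 15 * (1 / 2) ^+ n + 5 / 2 * (1 / 3) ^+ n.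

Lemma multiplierK : multiplier * inv_multiplier = 1.
Proof.
apply/funext => n; rewrite (fps_seqM (m := 4)) // 4!big_ord_recl big_ord0 /=.
rewrite /bump /= /inv_multiplier fps_coef1.
by case: n => [|[|[|n]]] /=; rewrite ?subSS ?subn0 ?exprS; field.
Qed.

Lemma accretive_inv_multiplier : accretive inv_multiplier.
Proof.
have [w [G [M /accretive_certificate cert]]] := multiplier_certificate.
have -> : inv_multiplier = 30 *: (fps_seq (map (Zr R) [:: 1%R]) * (30^-1 *: inv_multiplier)).
  rewrite -scalerAr scalerA divff ?pnatr_eq0 // scale1r -[LHS]mul1r.
  by congr (_ * _); apply/funext => -[//|n]; rewrite /fps_seq /= nth_nil.
apply: accretiveZ => //; apply: cert.
rewrite (_ : fps_seq _ = 30 *: multiplier).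
  by rewrite -scalerAr -scalerAl scalerA mulVf ?pnatr_eq0 // scale1r multiplierK.
have -> : map (Zr R) scaled_multiplier = [:: 30; -43; 20; -3] by [].
apply/funext => -[|[|[|[|n]]]]; rewrite fps_coefZ /multiplier /fps_seq /= ?nth_nil;
  by [rewrite mulr0 | field].
Qed.

(* With [60 P = (1 - X) p] and [900 D = (1 + X) p + (1 - X) k], the quotient
   [15 D / P = (1 + X) / (1 - X) + k / p] has its pole at [X = 1] isolated in the
   first summand, and [k / p] is strictly accretive. *)
Lemma accretive_bdf6_quotient : accretive (bdf6 * inv_multiplier).
Proof.
pose p : fps R := fps_seq [:: 147; -213; 237; -163; 62; -10].
pose k : fps R := fps_seq [:: 753; -471; 105; -59; 42; -10].
pose s : fps R := fps_seq [:: 1; 1].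
pose d : fps R := fps_seq [:: 1; -1].
have size2 (x y : R) : (size [:: x; y] <= 2)%N by [].
have bdf6E : 60 *: bdf6 = d * p.
  apply/funext => n; rewrite fps_coefZ (fps_seqM _ _ (size2 _ _)) !big_ord_recl big_ord0.
  rewrite /bdf6 /p /fps_seq /bump /=.
  by case: n => [|[|[|[|[|[|[|n]]]]]]]; rewrite /= ?nth_nil; field.
have multE : 900 *: multiplier = s * p + d * k.
  apply/funext => n; rewrite fps_coefZ fps_coefD !(fps_seqM _ _ (size2 _ _)).
  rewrite !big_ord_recl !big_ord0 /multiplier /p /k /fps_seq /bump /=.
  by case: n => [|[|[|[|[|[|[|n]]]]]]]; rewrite /= ?nth_nil; field.
have [pi ppi] : exists pi, p * pi = 1.
  by apply: fps_inv; rewrite /fps_seq /= pnatr_eq0.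
have [di ddi] : exists di, d * di = 1.
  by apply: fps_inv; rewrite /fps_seq /= oner_eq0.
have acc : accretive (s * di + k * pi).
  apply: accretiveD; first exact: (accretive_certificate cayley_certificate ddi).
  by have [w [G [M cert]]] := reduced_certificate; exact: (accretive_certificate cert ppi).
(* The series multiplied by 15 is [P / (15 D)], the inverse of the one in [acc]. *)
have -> : bdf6 * inv_multiplier = 15 *: (d * p * (900^-1 *: inv_multiplier)).
  have c1 : 15 * 900^-1 * 60 = 1 :> R by field.
  by rewrite -bdf6E -scalerAr -scalerAl !scalerA c1 scale1r.
apply: accretiveZ => //; apply: accretive_inv acc.
rewrite (_ : _ * _ = (s * p + d * k) * (900^-1 *: inv_multiplier)); last by ring: ppi ddi.
rewrite -multE -scalerAr -scalerAl scalerA mulVf ?pnatr_eq0 // scale1r.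
exact: multiplierK.
Qed.

End Bdf6.

(** * From convergent power series to formal ones *)

Section PowerSeries.
Variable R : realType.
Implicit Types (a b : fps R) (h : R -> R) (z : R).

Lemma pseriesS a z n :
  pseries a z n.+1 = a 0%N + z * pseries (fun i => a i.+1) z n.
Proof.
rewrite /pseries /series /= big_nat_recl // expr0 mulr1 mulr_sumr; congr (_ + _).
by apply: eq_bigr => i _; rewrite exprS mulrCA.
Qed.

Lemma cvg_pseries_cons a z l :
  pseries (fun i => a i.+1) z @ \oo --> l -> pseries a z @ \oo --> a 0%N + z * l.
Proof.
move=> al; rewrite -cvg_shiftS.
rewrite (_ : [sequence _]_n = fun n => a 0%N + z * pseries (fun i => a i.+1) z n).
  by apply: cvgD; [exact: cvg_cst | apply: cvgM => //; exact: cvg_cst].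
by apply/funext => n; rewrite /= pseriesS.
Qed.

(** The quotient of [r ^+ n.+1 - t ^+ n.+1] by [r - t] is a sum of [n.+1] products, each at least
    [t ^+ n]. This dominates a differentiated series by the original one at a larger radius. *)
Lemma natr_expr_le (t r : R) n : 0 <= t -> t <= r ->
  n.+1%:R * t ^+ n * (r - t) <= r ^+ n.+1.
Proof.
move=> t0 tr; have tn m : 0 <= t ^+ m by rewrite exprn_ge0.
suff: n.+1%:R * t ^+ n * (r - t) <= r ^+ n.+1 - t ^+ n.+1.
  by move=> /le_trans; apply; rewrite gerBl.
elim: n => [|n IHn]; first by rewrite mul1r expr0 mul1r !expr1.
have -> : r ^+ n.+2 - t ^+ n.+2 =
    r * (r ^+ n.+1 - t ^+ n.+1) + t ^+ n.+1 * (r - t) by rewrite !exprS; ring.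
rewrite -natr1 mulrDl mulrDl mul1r lerD2r.
have -> : n.+1%:R * t ^+ n.+1 * (r - t) = t * (n.+1%:R * t ^+ n * (r - t)).
  by rewrite exprS; ring.
by apply: ler_pM => //; rewrite !mulr_ge0 // subr_ge0.
Qed.

Lemma is_cvg_pseries_diffs a x z :
  cvgn (pseries a x) -> `|z| < `|x| -> cvgn (pseries (pseries_diffs a) z).
Proof.
move=> ax zx; pose r := (`|z| + `|x|) / 2.
have [zr rx] : `|z| < r /\ r < `|x| by rewrite /r; split; lra.
have r0 : 0 < r by apply: le_lt_trans zr.
pose u n := `|a n| * r ^+ n.
have /cvg_ex[/= l ul] : cvgn (series u).
  by apply: (is_cvg_pseries_inside_norm ax); rewrite gtr0_norm.
have uS : cvgn (series (fun n => u n.+1)).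
  apply/cvg_ex; exists (l - u 0%N).
  rewrite (_ : series _ = fun n => series u n.+1 - u 0%N).
    by apply: cvgB; [rewrite -cvg_shiftS in ul | exact: cvg_cst].
  by apply/funext => n; rewrite /series /= [in RHS]big_nat_recl // addrC addKr.
apply: normed_cvg.
apply: (@series_le_cvg _ _ (fun n => (r - `|z|)^-1 * u n.+1)) => [n|n|n|].
- exact: normr_ge0.
- have rz : 0 <= (r - `|z|)^-1 by rewrite invr_ge0 subr_ge0 ltW.
  have rn : 0 <= r ^+ n.+1 by rewrite exprn_ge0 // ltW.
  exact: mulr_ge0 rz (mulr_ge0 (normr_ge0 _) rn).
- rewrite /= /pseries_diffs !normrM normrX normr_nat /u [leRHS]mulrC ler_pdivlMr ?subr_gt0 //.
  rewrite (_ : _ * _ * _ * _ = `|a n.+1| * (n.+1%:R * `|z| ^+ n * (r - `|z|))); last by ring.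
  by rewrite ler_wpM2l // natr_expr_le // ltW.
- exact: is_cvg_seriesZ.
Qed.

Lemma power_series_near h a : power_series_at0 h a ->
  exists2 e, 0 < e & forall z, `|z| < e -> pseries a z @ \oo --> h z.
Proof.
by move=> /nbhs_ballP[e /= e0 he]; exists e => // z ze; apply: he; rewrite /ball /= sub0r normrN.
Qed.

Lemma eq_power_series h h' a : (\forall z \near (0 : R), h z = h' z) ->
  power_series_at0 h a -> power_series_at0 h' a.
Proof.
move=> hh' ha; near=> z; have <- : h z = h' z by near: z.
by near: z.
Unshelve. all: by end_near. Qed.

Lemma power_series_derive h h' a : power_series_at0 h a ->
  (\forall z \near (0 : R), is_derive z (1 : R) h (h' z)) ->
  power_series_at0 h' (pseries_diffs a).
Proof.
move=> /power_series_near[e e0 ha] hh'.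
(* Each differentiation costs some radius, and [pseries_snd_diffs] asks for two: hence [e / 2],
   [e / 3], [e / 4]. *)
have ea : cvgn (pseries a (e / 2)).
  by apply/cvg_ex; exists (h (e / 2)); apply: ha; rewrite gtr0_norm; lra.
have ne k : 0 < k -> `|e / k| = e / k by move=> k0; rewrite gtr0_norm ?divr_gt0.
have e3 : cvgn (pseries (pseries_diffs a) (e / 3)).
  by apply: is_cvg_pseries_diffs ea _; rewrite !ne //; lra.
have e4 : cvgn (pseries (pseries_diffs a) (e / 4)).
  by apply: is_cvg_pseries_inside e3 _; rewrite !ne //; lra.
have e4' : cvgn (pseries (pseries_diffs (pseries_diffs a)) (e / 4)).
  by apply: is_cvg_pseries_diffs e3 _; rewrite !ne //; lra.
have ea4 : cvgn (pseries a (e / 4)).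
  by apply: is_cvg_pseries_inside ea _; rewrite !ne //; lra.
have e4_gt0 : 0 < e / 4 by rewrite divr_gt0.
near=> z.
have ze : `|z| < e / 4 by near: z; exact: (@nbhs0_lt _ R^o _ e4_gt0).
have dz : is_derive z (1 : R) h (h' z) by near: z.
have := @pseries_snd_diffs _ a (e / 4) z ea4 e4 e4'.
rewrite ne // => /(_ ze) dlim.
have dlim' : is_derive z (1 : R) h (limn (pseries (pseries_diffs a) z)).
  apply: near_eq_is_derive dlim; near=> y; apply/cvg_lim => //; apply: ha.
  near: y; apply: (cvgr_lt _ (@norm_continuous _ _ z)).
  by apply: lt_trans ze _; lra.
have <- : limn (pseries (pseries_diffs a) z) = h' z.
  by rewrite -(derive_val (is_derive := dz)) -(derive_val (is_derive := dlim')).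
by apply: is_cvg_pseries_inside e4 _; rewrite ne.
Unshelve. all: by end_near. Qed.

Lemma power_series_coef0 h a : power_series_at0 h a -> a 0%N = h 0.
Proof.
move=> /nbhs_singleton; rewrite -cvg_shiftS.
rewrite (_ : [sequence _]_n = fun=> a 0%N); last first.
  by apply/funext => n; rewrite /= pseriesS mul0r addr0.
by move=> a0h; apply: (cvg_unique _ _ a0h); [exact: Rhausdorff | exact: cvg_cst].
Qed.

(** The value at 0 kills the constant term, and the differentiated series again represents 0. *)
Lemma power_series0 a : power_series_at0 (fun=> 0) a -> a = 0.
Proof.
move=> a0; apply/funext => n; elim: n a a0 => [|n IHn] a a0.
  by rewrite (power_series_coef0 a0).
have /IHn/eqP : power_series_at0 (fun=> 0) (pseries_diffs a).
  by apply: power_series_derive a0 _; near=> z; exact: is_derive_cst.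
by rewrite /pseries_diffs mulf_eq0 pnatr_eq0 /= => /eqP.
Unshelve. all: by end_near. Qed.

Lemma power_seriesD h1 h2 a b : power_series_at0 h1 a -> power_series_at0 h2 b ->
  power_series_at0 (fun z => h1 z + h2 z) (a + b).
Proof.
move=> ha hb; near=> z.
rewrite (_ : pseries _ z = fun n => pseries a z n + pseries b z n).
  by apply: cvgD; near: z.
apply/funext => n; rewrite /pseries /series /= -big_split; apply: eq_bigr => i _.
exact: mulrDl.
Unshelve. all: by end_near. Qed.

Lemma power_seriesZ k h a : power_series_at0 h a ->
  power_series_at0 (fun z => k * h z) (k *: a).
Proof.
move=> ha; near=> z.
rewrite (_ : pseries _ z = fun n => k * pseries a z n).
  by apply: cvgM; [exact: cvg_cst | near: z].
apply/funext => n; rewrite /pseries /series /= mulr_sumr; apply: eq_bigr => i _.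
exact/esym/mulrA.
Unshelve. all: by end_near. Qed.

Lemma power_series_shift h a : a 0%N = 0 ->
  power_series_at0 h (fun n => a n.+1) -> power_series_at0 (fun z => z * h z) a.
Proof.
move=> a0 ha; near=> z; rewrite -[X in _ --> X]add0r -a0.
by apply: cvg_pseries_cons; near: z.
Unshelve. all: by end_near. Qed.

(** Horner's scheme reduces the product to shifts, scalings and sums. *)
Lemma power_seriesM (p : {poly R}) h a : power_series_at0 h a ->
  power_series_at0 (fun z => p.[z] * h z) (fps_seq p * a).
Proof.
move=> ha; elim/poly_ind: p => [|p c IHp].
  rewrite (_ : fps_seq _ = 0) ?mul0r; last by apply/funext => n; rewrite /fps_seq coef0.
  near=> z; rewrite horner0 mul0r.
  rewrite (_ : pseries _ z = fun=> 0); first exact: cvg_cst.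
  by apply/funext => n; rewrite /pseries /series /= big1 // => i _; rewrite mul0r.
pose s : fps R := fun n => if n is m.+1 then (fps_seq p * a) m else 0.
rewrite (_ : fps_seq _ * a = s + c *: a); last first.
  apply/funext => n; rewrite fps_coefD fps_coefZ /fps_seq fps_coefM.
  case: n => [|n] /=.
    by rewrite big_ord1 coefD coefMX coefC eqxx /= !add0r.
  rewrite big_ord_recl /= coefD coefMX coefC eqxx add0r addrC; congr (_ + _).
  by apply: eq_bigr => i _; rewrite coefD coefMX coefC /= addr0 subSS.
rewrite (_ : (fun z => _) = fun z => z * (p.[z] * h z) + c * h z); last first.
  by apply/funext => z; rewrite hornerMXaddC; ring.
by apply: power_seriesD; [apply: power_series_shift | apply: power_seriesZ].
Unshelve. all: by end_near. Qed.


(* [f = p `^ al] satisfies [p f' = al p' f]. *)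
Lemma power_series_powR (p : {poly R}) al a : 0 < p.[0] ->
  power_series_at0 (fun z => p.[z] `^ al) a ->
  a 0%N = p.[0] `^ al /\ fps_seq p * euler a = al *: (euler (fps_seq p) * a).
Proof.
move=> p0 ha; split; first exact: (power_series_coef0 ha).
pose f' z := al * p.[z] `^ (al - 1) * p^`().[z].
have pz_gt0 : \forall z \near (0 : R), 0 < p.[z].
  exact: (cvgr_gt _ (@continuous_horner _ p 0)).
have hda : power_series_at0 f' (pseries_diffs a).
  apply: power_series_derive ha _; near=> z.
  apply: (@is_derive1_comp _ (fun y => y `^ al) (horner p)).
  - by apply: is_derive1_powR; near: z.
  - exact: is_derive_poly.
have hea : power_series_at0 (fun z => z * f' z) (euler a).
  by apply: power_series_shift hda; rewrite /euler mul0r.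
have hl := power_seriesM p hea.
have hr := power_seriesM ('X * p^`()) ha.
have eX : fps_seq ('X * p^`()) = euler (fps_seq p).
  apply/funext => n; rewrite /fps_seq /euler mulrC coefMX.
  by case: n => [|n]; rewrite ?mul0r //= coef_deriv mulr_natl.
(* The difference of the two sides represents the zero function near 0. *)
apply/eqP; rewrite -subr_eq0 -scaleNr; apply/eqP/power_series0.
have := power_seriesD hl (power_seriesZ (- al) hr).
rewrite eX; apply: eq_power_series.
near=> z; have pz : 0 < p.[z] by near: z.
have -> : p.[z] `^ al = p.[z] * p.[z] `^ (al - 1).
  have := @powRD R p.[z] 1 (al - 1); rewrite powRr1 ?ltW // addrCA subrr addr0.
  by apply; rewrite (gt_eqF pz) implybT.
by rewrite /f' hornerM hornerX; ring.
Unshelve. all: by end_near. Qed.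

End PowerSeries.

(** * The substitution of [c X] for [X] *)

Section Scaling.
Variable R : realType.
Implicit Types (a b y : fps R) (c : R).

Definition fps_scale c a : fps R := fun n => c ^+ n * a n.

Lemma fps_scaleM c a b : fps_scale c (a * b) = fps_scale c a * fps_scale c b.
Proof.
apply/funext => n; rewrite /fps_scale !fps_coefM mulr_sumr; apply: eq_bigr => i _.
by rewrite -{1}(subnKC (ltn_ord i : (i <= n)%N)) exprD mulrACA.
Qed.

Lemma fps_scaleZ c k a : fps_scale c (k *: a) = k *: fps_scale c a.
Proof. by apply/funext => n; rewrite /fps_scale !fps_coefZ mulrCA. Qed.

Lemma euler_scale c a : euler (fps_scale c a) = fps_scale c (euler a).
Proof. by apply/funext => n; rewrite /fps_scale /euler mulrCA. Qed.

Lemma fps_pow_scale c a al y :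
  is_fps_pow a al y -> is_fps_pow (fps_scale c a) al (fps_scale c y).
Proof.
move=> [y0 yE]; split; first by rewrite /fps_scale y0 mulr1.
by rewrite !euler_scale -!fps_scaleM yE fps_scaleZ.
Qed.

(** Abel summation as an induction: a nonnegative partial sum can only decrease when its factor
    passes from [x ^+ N] to [x ^+ N.+1]. *)
Lemma abel_sum_ge (x : R) (t : nat -> R) N : 0 <= x <= 1 ->
  (forall m, 0 <= \sum_(n < m) t n) ->
  x ^+ N * \sum_(n < N) t n <= \sum_(n < N) x ^+ n * t n.
Proof.
move=> /andP[x0 x1] t0; elim: N => [|N IHN]; first by rewrite !big_ord0 mulr0.
rewrite [leRHS]big_ord_recr /=.
apply: le_trans (_ : x ^+ N * \sum_(n < N.+1) t n <= _).
  by rewrite exprSr -mulrA ler_wpM2l ?exprn_ge0 // ler_piMl // t0.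
by rewrite big_ord_recr /= mulrDr lerD2r.
Qed.

(* The weights [c ^+ (2 n)] produced by [v n = c ^+ n *: u n] are decreasing, so
   that Abel summation applies. *)
Lemma accretive_scale c a : 0 < c <= 1 -> accretive a -> accretive (fps_scale c a).
Proof.
move=> /andP[c0 c1] ha V B hB v N.
have cn n : c ^+ n != 0 by rewrite expf_neq0 // gt_eqF.
pose u n := (c ^+ n)^-1 *: v n.
have termE n : B (conv (fps_scale c a) v n) (v n) =
    (c ^+ 2) ^+ n * B (conv a u n) (u n).
  rewrite -exprM mulnC exprM expr2 -mulrA -(psd_formZr hB) -(psd_formZl hB).
  rewrite /u !scalerA divff // scale1r; congr (B _ _); rewrite /conv scaler_sumr.
  apply: eq_bigr => i _; rewrite !scalerA /fps_scale; congr (_ *: _).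
  have -> : c ^+ n = c ^+ i * c ^+ (n - i) by rewrite -exprD subnKC // -ltnS.
  rewrite -!mulrA; congr (_ * _).
  by rewrite mulrCA divff ?mulr1.
under eq_bigr do rewrite termE.
have c2 : 0 <= c ^+ 2 <= 1 by rewrite exprn_ge0 ?exprn_ile1 // ltW.
have t0 m : 0 <= \sum_(n < m) B (conv a u n) (u n) by exact: ha.
apply: le_trans (abel_sum_ge (t := fun n => B (conv a u n) (u n)) N c2 t0).
by rewrite mulr_ge0 // exprn_ge0 //; case/andP: c2.
Qed.

End Scaling.

(** * Identification of the coefficients [g] and [q6] *)

Section Bdf6Coefficients.
Variables (R : realType) (alpha sigma tau : R) (g : nat -> R).
Hypothesis hg : is_bdf_coef 6 alpha sigma tau g.

Let c := expR (- (sigma * tau)).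

(** [is_fps_pow] is normalized to constant term 1, whereas [P] starts with 49/20; [K] is [49/20] to
    the power [alpha]. *)
Lemma bdf6_coef y : is_fps_pow ((20 / 49) *: bdf6 R) alpha y ->
  exists2 K, 0 < K & g = K *: fps_scale c y :> fps R.
Proof.
move=> hy.
pose s := [:: 49 / 20; -6 * c; 15 / 2 * c ^+ 2; - (20 / 3) * c ^+ 3;
           15 / 4 * c ^+ 4; - (6 / 5) * c ^+ 5; 1 / 6 * c ^+ 6].
have sE z : (Poly s).[z] = bdf_symbol 6 sigma tau z.
  by rewrite horner_Poly /bdf_symbol /index_iota /= !big_cons big_nil /= -/c; field.
have s0 : (Poly s).[0] = 49 / 20 by rewrite horner_Poly /= mulr0 add0r.
have fpsE : fps_seq (Poly s) = fps_scale c (bdf6 R).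
  apply/funext => n; rewrite /fps_seq coef_Poly /fps_scale /bdf6 /fps_seq /s.
  by case: n => [|[|[|[|[|[|[|n]]]]]]] /=; rewrite ?nth_nil; ring.
have s0_gt0 : 0 < (Poly s).[0] by rewrite s0; lra.
have hg' : power_series_at0 (fun z => (Poly s).[z] `^ alpha) g.
  by rewrite (_ : (fun z => _) = fun z => bdf_symbol 6 sigma tau z `^ alpha) //;
    apply/funext => z; rewrite sE.
have [g0 gE] := power_series_powR s0_gt0 hg'.
set K := (Poly s).[0] `^ alpha in g0; have K0 : 0 < K by rewrite powR_gt0.
exists K => //.
have a0 : (fps_scale c ((20 / 49) *: bdf6 R)) 0%N = 1.
  by rewrite /fps_scale fps_coefZ /bdf6 /fps_seq /= expr0; field.
have -> : fps_scale c y = K^-1 *: g; last by rewrite scalerA divff ?scale1r ?gt_eqF.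
apply: (fps_pow_unique a0 (fps_pow_scale c hy)).
split; first by rewrite fps_coefZ g0 mulVf ?gt_eqF.
rewrite fps_scaleZ -fpsE !eulerZ -!scalerAl -!scalerAr gE !scalerA.
by congr (_ *: _); ring.
Qed.

Lemma q6E y K : g = K *: fps_scale c y :> fps R -> 
  q6 sigma tau g = K *: fps_scale c (y * inv_multiplier R) :> fps R.
Proof.
move=> gE; rewrite mulrC fps_scaleM fps_scalerAr -gE; apply/funext => j.
rewrite /q6 fps_coefM big_mkord; apply: eq_bigr => m _; congr (_ * _).
rewrite /fps_scale mulrC; congr (_ * _).
  by rewrite /c -expRM_natl mulrN; congr expR; ring.
(* Over the denominator [30 ^+ m] the partial fractions become the weights of [q6]:
   [243 / 18 = 27 / 2] and [25 / 10 = 5 / 2]. *)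
have p1 : (3 / 5) ^+ m = 18 ^+ m / 30 ^+ m :> R.
  by rewrite -expr_div_n; congr (_ ^+ _); field.
have p2 : (1 / 2) ^+ m = 15 ^+ m / 30 ^+ m :> R.
  by rewrite -expr_div_n; congr (_ ^+ _); field.
have p3 : (1 / 3) ^+ m = 10 ^+ m / 30 ^+ m :> R.
  by rewrite -expr_div_n; congr (_ ^+ _); field.
rewrite /inv_multiplier p1 p2 p3 !expfzDr ?pnatr_eq0 // -!exprnP expr1 !exprN1.
by field; rewrite expf_neq0 // pnatr_eq0.
Qed.

Lemma accretive_q6 : 0 <= alpha <= 1 -> 0 <= sigma -> 0 <= tau ->
  accretive (q6 sigma tau g : fps R).
Proof.
move=> al01 sigma0 tau0.
have a0 : ((20 / 49) *: bdf6 R) 0%N = 1 by rewrite fps_coefZ /bdf6 /fps_seq /=; field.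
have e0 : inv_multiplier R 0%N = 1 by rewrite /inv_multiplier !expr0; field.
have [y hy] := fps_pow_exists alpha a0.
have [K K0 gE] := bdf6_coef hy.
rewrite (q6E gE); apply: accretiveZ; first exact: ltW.
apply: accretive_scale.
  by rewrite expR_gt0 /= -[leRHS](@expR0 R) ler_expR oppr_le0 mulr_ge0.
apply: accretive_interpolation a0 e0 _ _ al01 hy; first exact: accretive_inv_multiplier.
by rewrite -scalerAl; apply: accretiveZ; [rewrite divr_ge0 | exact: accretive_bdf6_quotient].
Qed.

End Bdf6Coefficients.

(** * Transfer to real and complex Hilbert spaces *)

Lemma accretive_sum1 (R : realType) (a : fps R) (V : lmodType R) (B : V -> V -> R) :
  accretive a -> psd_form B -> forall (v : nat -> V) N,
  0 <= \sum_(1 <= n < N.+1) B (\sum_(0 <= j < n) a j *: v (n - j)%N) (v n).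
Proof.
move=> ha hB v N; rewrite big_add1 big_mkord.
(* The values are numbered from 1, so that accretivity is applied to the shifted sequence
   [v m.+1]. *)
rewrite (eq_bigr (fun n : 'I_N => B (conv a (fun m => v m.+1) n) (v n.+1))); first exact: ha.
move=> n _; congr (B _ _); rewrite big_mkord; apply: eq_bigr => j _.
by rewrite subSn // -ltnS.
Qed.

(** Restriction of scalars to [R]; the alias keeps the real scaling apart from the complex one. *)
Definition realified (R : realType) (H : lmodType R[i]) : Type := H.

Section Realified.
Variables (R : realType) (H : lmodType R[i]).

HB.instance Definition _ := GRing.Zmodule.copy (realified H) H.

Let scale (k : R) (x : realified H) : realified H := k%:C%C *: (x : H).

Let scaleA k l x : scale k (scale l x) = scale (k * l) x.
Proof. by rewrite /scale scalerA -rmorphM. Qed.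
Let scale1 : left_id 1 scale.
Proof. by move=> x; rewrite /scale rmorph1 scale1r. Qed.
Let scaleDr : right_distributive scale +%R.
Proof. by move=> k x y; exact: scalerDr. Qed.
Let scaleDl x : {morph scale^~ x : k l / k + l}.
Proof. by move=> k l; rewrite /scale rmorphD scalerDl. Qed.

HB.instance Definition _ :=
  GRing.Zmodule_isLmodule.Build R (realified H) scaleA scale1 scaleDr scaleDl.

End Realified.
Lemma psd_form_dot (R : realType) (H : completeNormedModType R)
    (dot : {dot H for idfun}) :
  (forall x : H, `|x| ^+ 2 = dot x x) -> psd_form (dot : H -> H -> R).
Proof.
move=> hdot; split=> [k x y z|x y|x]; first exact: linearPl.
  by rewrite [LHS]hermC expr0 mul1r.
by rewrite -hdot exprn_ge0.
Qed.

(** Hermitian symmetry becomes symmetry, since conjugation fixes the real part. *)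
Lemma psd_form_Re_dot (R : realType) (H : completeNormedModType R[i])
    (dot : {dot H for Num.conj}) :
  (forall x : H, `|x| ^+ 2 = dot x x) ->
  psd_form (V := realified H) (fun x y => complex.Re (dot x y)).
Proof.
move=> hdot; split=> [k x y z|x y|x].
- rewrite [dot _ _]linearPl /=; case: (dot x z) => a b; case: (dot y z) => a' b' /=.
  by rewrite mul0r subr0.
- have -> : dot x y = (dot y x)^* by rewrite [LHS]hermC expr0 mul1r.
  by case: (dot y x).
- have : 0 <= dot x x by rewrite -hdot exprn_ge0.
  by rewrite lecE => /andP[].
Qed.

Theorem lemma3p8 (R : realType) (alpha sigma tau : R) (g : nat -> R)
    (halpha : 0 < alpha < 1) (hsigma : 0 <= sigma) (htau : 0 < tau)
    (hg : is_bdf_coef 6 alpha sigma tau g) :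
  (* real scalars *)
  (forall (H : completeNormedModType R) (dot : {dot H for idfun})
          (hdot : forall x : H, `|x| ^+ 2 = dot x x)
          (N : nat) (v : nat -> H), (0 < N)%N ->
     0 <= \sum_(1 <= n < N.+1)
            dot (\sum_(0 <= j < n) q6 sigma tau g j *: v (n - j)%N) (v n))
  /\
  (* complex scalars *)
  (forall (H : completeNormedModType R[i]) (dot : {dot H for Num.conj})
          (hdot : forall x : H, `|x| ^+ 2 = dot x x)
          (N : nat) (v : nat -> H), (0 < N)%N ->
     0 <= complex.Re (\sum_(1 <= n < N.+1)
            dot (\sum_(0 <= j < n) (q6 sigma tau g j)%:C%C *: v (n - j)%N) (v n))).
Proof.
have al01 : 0 <= alpha <= 1 by case/andP: halpha => /ltW -> /ltW ->.
have hq := accretive_q6 hg al01 hsigma (ltW htau).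
split=> H dot hdot N v _; first exact: (accretive_sum1 hq (psd_form_dot hdot)).
have := accretive_sum1 hq (psd_form_Re_dot hdot) v N.
by rewrite (big_morph _ (raddfD (@complex.Re R)) (raddf0 _)).
Qed.
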